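(* Let $d\ge4$ be an even integer and let $(a,b)$ belong to the interior of the set $$\Big\{(a,b)\in\mathbb{R}^2:\ \tfrac1{d-3}a+b>\tfrac1{d+1},\ \ a+(1+d)b\le1,\ \ (1+d)a+b\le1\Big\}.$$ Let $$\rho_{a,b}=\frac{1-a-b}{d^2}I_d\otimes I_d+a|\omega_d\rangle\langle\omega_d|+\frac bd(I_d\otimes\Omega_d)F_d(I_d\otimes\Omega_d)^*.$$ Then for all sufficiently small $\varepsilon>0$, the state $$\rho_{AB}=(1-\varepsilon)\rho_{a,b}+\varepsilon(I_d\otimes\Omega_d)|\omega_d\rangle\langle\omega_d|(I_d\otimes\Omega_d)^*$$ on $\mathbb{C}^d\otimes\mathbb{C}^d$ is PPT with $\mathrm{SN}(\rho_{AB})\ge d/2$.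
   Context: $\Omega_d=\begin{pmatrix}0&I_{d/2}\\-I_{d/2}&0\end{pmatrix}$, $|\omega_d\rangle=\frac1{\sqrt d}\sum_{j=1}^d|jj\rangle$, $F_d=\sum_{i,j=1}^d|ij\rangle\langle ji|$. A quantum state is a positive semidefinite trace-one matrix; it is PPT if its partial transpose $(\mathrm{id}\otimes\top)(\rho)$ is positive semidefinite. The Schmidt number $\mathrm{SN}(\rho)$ is the smallest $k$ such that $\rho$ is a convex combination of pure states $|\xi\rangle\langle\xi|$ with $\xi$ of Schmidt rank at most $k$. (The displayed set consists of exactly those $(a,b)$ for which $\rho_{a,b}$ is a PPT state with Schmidt number larger than $d/2-1$.) *)

(* Defs.v *)
From HB Require Import structures.
From mathcomp Require Import all_boot all_order all_algebra.
From mathcomp Require Import sesquilinear spectral.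
From mathcomp Require Import complex mxtens.
From mathcomp Require Import all_classical all_reals all_analysis.
Set Implicit Arguments.
Unset Strict Implicit.
Unset Printing Implicit Defensive.
Import Order.TTheory GRing.Theory Num.Theory.
Import numFieldNormedType.Exports.
Local Open Scope classical_set_scope.
Local Open Scope complex_scope.
Local Open Scope sesquilinear_scope.
Local Open Scope ring_scope.

Section Quantum.
Variable R : realType.
Local Notation C := R[i].

(* The order of C makes [0 <= z] mean that z is a nonnegative real. *)
Definition psdmx n (A : 'M[C]_n) : Prop :=
  A \is hermsymmx /\ forall v : 'cV[C]_n, 0 <= (v ^t* *m A *m v) 0 0.

Definition quantum_state n (rho : 'M[C]_n) : Prop := psdmx rho /\ \tr rho = 1.

(* The second tensor factor is the one that is transposed; see ptransE. *)
Definition ptrans m n (X : 'M[C]_(m * n)) : 'M[C]_(m * n) :=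
  \matrix_(p, q)
    X (mxtens_index ((mxtens_unindex p).1, (mxtens_unindex q).2))
      (mxtens_index ((mxtens_unindex q).1, (mxtens_unindex p).2)).

Lemma ptransE m n (A : 'M[C]_m) (B : 'M[C]_n) : ptrans (A *t B) = A *t B^T.
Proof.
apply/matrixP => p q.
case: (mxtens_indexP p) => i k; case: (mxtens_indexP q) => j l.
by rewrite mxE !mxtens_indexK !tensmxE mxE.
Qed.

Definition is_ppt m n (rho : 'M[C]_(m * n)) : Prop := psdmx (ptrans rho).

Definition tensv m n (x : 'cV[C]_m) (y : 'cV[C]_n) : 'cV[C]_(m * n) := x *t y.

Definition ketbra n (x : 'cV[C]_n) : 'M[C]_n := x *m x ^t*.

Definition orthonormal_family r n (e : 'I_r -> 'cV[C]_n) : Prop :=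
  forall i j, ((e i) ^t* *m e j) 0 0 = (i == j)%:R.

(* r is the number of (positive) coefficients in a Schmidt decomposition. *)
Definition has_schmidt_rank m n (xi : 'cV[C]_(m * n)) (r : nat) : Prop :=
  exists (s : 'I_r -> R) (e : 'I_r -> 'cV[C]_m) (f : 'I_r -> 'cV[C]_n),
    [/\ forall i, 0 < s i, orthonormal_family e, orthonormal_family f &
        xi = \sum_(i < r) (s i)%:C *: tensv (e i) (f i)].

Definition schmidt_number_le m n (rho : 'M[C]_(m * n)) (k : nat) : Prop :=
  exists (N : nat) (p : 'I_N -> R) (xi : 'I_N -> 'cV[C]_(m * n)),
    [/\ forall i, 0 <= p i, \sum_(i < N) p i = 1,
        forall i, ((xi i) ^t* *m xi i) 0 0 = 1,
        forall i, exists2 r, has_schmidt_rank (xi i) r & (r <= k)%N &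
        rho = \sum_(i < N) (p i)%:C *: ketbra (xi i)].

(* The value is 0 when there is no decomposition at all, which does not happen
   for a quantum state; no convex combination of pure states has Schmidt
   number 0. *)
Definition schmidt_number m n (rho : 'M[C]_(m * n)) : nat :=
  xget 0%N [set k | schmidt_number_le rho k /\
                    forall j, schmidt_number_le rho j -> (k <= j)%N].

Variable d : nat.

Definition Omega : 'M[C]_d :=
  \matrix_(i, j) ((j == i + d./2 :> nat)%N%:R - (i == j + d./2 :> nat)%N%:R).

Definition ket (i : 'I_d) : 'cV[C]_d := delta_mx i 0.

Definition omega : 'cV[C]_(d * d) :=
  (sqrtC d%:R)^-1 *: \sum_(j < d) tensv (ket j) (ket j).

Definition flip : 'M[C]_(d * d) :=
  \sum_(i < d) \sum_(j < d) tensv (ket i) (ket j) *m (tensv (ket j) (ket i)) ^t*.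

Definition IOmega : 'M[C]_(d * d) := 1%:M *t Omega.

Definition rho_ab (a b : R) : 'M[C]_(d * d) :=
  ((1 - a - b) / d%:R ^+ 2)%:C *: (1%:M *t 1%:M)
  + a%:C *: ketbra omega
  + (b / d%:R)%:C *: (IOmega *m flip *m IOmega ^t*).

Definition rho_AB (a b eps : R) : 'M[C]_(d * d) :=
  (1 - eps)%:C *: rho_ab a b
  + eps%:C *: (IOmega *m ketbra omega *m IOmega ^t*).

Definition region : set (R * R) :=
  [set p | [/\ (d%:R - 3)^-1 * p.1 + p.2 > (d%:R + 1)^-1,
               p.1 + (1 + d%:R) * p.2 <= 1 &
               (1 + d%:R) * p.1 + p.2 <= 1]].

End Quantum.

Arguments region R d : clear implicits.
Arguments Omega {R} d.
Arguments omega {R} d.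
Arguments flip {R} d.
Arguments IOmega {R} d.
Arguments rho_ab {R} d a b.
Arguments rho_AB {R} d a b eps.

Lemma Omega_block (R : realType) (m : nat) :
  Omega (m + m) = block_mx 0 1%:M (- 1%:M) 0 :> 'M[R[i]]_(m + m).
Proof.
have half : ((m + m)./2 = m)%N by rewrite addnn doubleK.
have neq (x y : 'I_m) : (x == y + m + m :> nat)%N = false.
  by rewrite ltn_eqF // -addnA ltn_addl // ltn_addr.
apply/matrixP => i j; rewrite mxE half.
case: (split_ordP i) => i' ->; case: (split_ordP j) => j' ->;
  rewrite ?block_mxEul ?block_mxEur ?block_mxEdl ?block_mxEdr !mxE /=.
- by rewrite !ltn_eqF ?subr0 ?ltn_addl.
- by rewrite ![(m + _)%N]addnC eqn_add2r neq subr0 eq_sym.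
- by rewrite ![(m + _)%N]addnC eqn_add2r neq sub0r.
- by rewrite ![(m + _)%N]addnC !eqn_add2r !ltn_eqF ?subr0 ?ltn_addl.
Qed.

(* Main.v *)
Require Import Defs.
From mathcomp Require Import all_boot all_order all_algebra.
From mathcomp Require Import sesquilinear spectral.
From mathcomp Require Import complex mxtens.
From mathcomp Require Import ring lra.
From mathcomp Require Import all_classical all_reals all_analysis.
Import Order.TTheory GRing.Theory Num.Theory.
Import numFieldNormedType.Exports.
Local Open Scope classical_set_scope.
Local Open Scope complex_scope.
Local Open Scope sesquilinear_scope.
Local Open Scope ring_scope.

Set Implicit Arguments.
Unset Strict Implicit.
Unset Printing Implicit Defensive.

(* Let d = 2k + 2, omega' = IOmega omega, F' = IOmega F IOmega^* with F the
   flip, and W = k I - d |omega><omega| - k F'.  Identify a vector v with the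
   d x d matrix V = unvec v.  Then F' is an involution with F' omega = - omega,
   so u = v - F' v satisfies |u|^2 = 2 (|v|^2 - <v, F' v>) and
   tr U = 2 sqrt d <omega, v>.  If v has Schmidt rank at most k, then U has rank
   at most 2k, and |tr U|^2 <= (rank U) |u|^2 says exactly that <v, W v> >= 0.
   Hence tr (W rho) >= 0 whenever SN(rho) <= k.  On the other hand tr (W rho_AB)
   is a positive multiple of 1/(d+1) - (a/(d-3) + b), which is negative; the
   perturbation |omega'><omega'| contributes nothing.

   Both rho_AB and its partial transpose are nonnegative combinations of I,
   |omega><omega|, |omega'><omega'|, I + F and I + F'.  This gives positivity,
   and, as these terms are explicit combinations of vectors in Schmidt form,
   also the existence of a Schmidt number. *)

(** * Adjoints, traces and a trace-rank inequality *)

Section Adjoint.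
Context {C : numClosedFieldType}.

Lemma adjmxE m n (A : 'M[C]_(m, n)) i j : A ^t* i j = (A j i)^*.
Proof. by rewrite !mxE. Qed.

Lemma adjmxM m n p (A : 'M[C]_(m, n)) (B : 'M[C]_(n, p)) :
  (A *m B) ^t* = B ^t* *m A ^t*.
Proof. by rewrite trmx_mul map_mxM. Qed.

Lemma adjmxD m n (A B : 'M[C]_(m, n)) : (A + B) ^t* = A ^t* + B ^t*.
Proof. by rewrite linearD map_mxD. Qed.

Lemma adjmxB m n (A B : 'M[C]_(m, n)) : (A - B) ^t* = A ^t* - B ^t*.
Proof. by rewrite linearB map_mxB. Qed.

Lemma adjmxZ m n c (A : 'M[C]_(m, n)) : (c *: A) ^t* = c^* *: A ^t*.
Proof. by rewrite linearZ map_mxZ. Qed.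

Lemma adjmx_sum m n I (r : seq I) (F : I -> 'M[C]_(m, n)) :
  (\sum_(i <- r) F i) ^t* = \sum_(i <- r) (F i) ^t*.
Proof. by rewrite raddf_sum /= raddf_sum. Qed.

Lemma adjmx1 n : (1%:M : 'M[C]_n) ^t* = 1%:M.
Proof. by rewrite trmx1 map_mx1. Qed.

Lemma mxtraceB n (A B : 'M[C]_n) : \tr (A - B) = \tr A - \tr B.
Proof. exact: raddfB. Qed.

Lemma mxtrace_adj n (A : 'M[C]_n) : \tr (A ^t*) = (\tr A)^*.
Proof. by rewrite /mxtrace rmorph_sum; apply: eq_bigr => i _; rewrite !mxE. Qed.

Lemma tr_adj_mul m n (A : 'M[C]_(m, n)) :
  \tr (A *m A ^t*) = \sum_i \sum_j `|A i j| ^+ 2.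
Proof.
apply: eq_bigr => i _; rewrite mxE; apply: eq_bigr => j _.
by rewrite !mxE normCK.
Qed.

Lemma tr_adj_mul_ge0 m n (A : 'M[C]_(m, n)) : 0 <= \tr (A *m A ^t*).
Proof.
by rewrite tr_adj_mul; do 2!apply: sumr_ge0 => ? _; exact: exprn_ge0.
Qed.

(* With [P] the orthogonal projection onto the row space of [S], this is the
   nonnegativity of the Hilbert-Schmidt norm of [\rank S *: S - \tr S *: P]. *)
Lemma norm_mxtrace_le_rank n (S : 'M[C]_n) :
  `|\tr S| ^+ 2 <= (\rank S)%:R * \tr (S *m S ^t*).
Proof.
have [r0|r_gt0] := posnP (\rank S).
  move/eqP: r0; rewrite mxrank_eq0 => /eqP ->.
  by rewrite mxtrace0 normr0 expr0n mxrank0 mul0r.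
set r := \rank S in r_gt0 *.
have rn : (r <= n)%N by exact: rank_leq_col.
(* Gram-Schmidt turns a basis of the row space of [S] into the orthonormal rows of [Q]. *)
pose Q : 'M[C]_(r, n) := schmidt (row_base S).
have QQ : Q *m Q ^t* = 1%:M by apply/unitarymxP; exact: schmidt_unitarymx.
have SQ : (S <= Q)%MS.
  by rewrite (eqmx_schmidt_free (row_base_free S)) eq_row_base.
pose P := Q ^t* *m Q.
have SP : S *m P = S.
  case/submxP: SQ => D ->.
  by rewrite /P !mulmxA -[D *m Q *m _]mulmxA QQ mulmx1.
have PH : P ^t* = P by rewrite /P adjmxM trmxCK.
have PP : P *m P = P by rewrite /P mulmxA -[_ *m Q *m _]mulmxA QQ mulmx1.
have trP : \tr P = r%:R by rewrite /P mxtrace_mulC QQ mxtrace1.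
have PS : P *m S ^t* = S ^t* by rewrite -{1}PH -adjmxM SP.
pose c := \tr S; rewrite -/c.
(* In the squared norm the two cross terms give [- r |c|^2] each and [\tr P = r] gives one back; the
   common factor [r] is positive and cancels. *)
have : 0 <= r%:R * (r%:R * \tr (S *m S ^t*) - `|c| ^+ 2).
  rewrite (le_trans (tr_adj_mul_ge0 (r%:R *: S - c *: P))) // le_eqVlt.
  rewrite adjmxB !adjmxZ PH mulmxBl !mulmxBr -!scalemxAl -!scalemxAr SP PS PP.
  rewrite !raddfB /= !mxtraceZ trP mxtrace_adj -/c conjC_nat normCK.
  by apply/orP; left; apply/eqP; ring.
by rewrite pmulr_rge0 ?ltr0n // subr_ge0.
Qed.

Lemma mxrank_sum_le m n (I : Type) (s : seq I) (F : I -> 'M[C]_(m, n)) :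
  (\rank (\sum_(i <- s) F i)%R <= \sum_(i <- s) \rank (F i))%N.
Proof.
elim/big_ind2: _ => [|A a B b leA leB|//]; first by rewrite mxrank0.
by apply: leq_trans (mxrank_add _ _) _; exact: leq_add.
Qed.

End Adjoint.

(** * Positive semidefinite matrices *)

Section Psd.
Context {R : realType}.
Local Notation C := R[i].

Lemma psdmxD n (A B : 'M[C]_n) : psdmx A -> psdmx B -> psdmx (A + B).
Proof.
move=> [/is_hermitianmxP hA pA] [/is_hermitianmxP hB pB]; split=> [|v].
  by apply/is_hermitianmxP; rewrite adjmxD scalerDr -hA -hB.
by rewrite mulmxDr mulmxDl mxE addr_ge0.
Qed.

Lemma psdmxZ n (c : R) (A : 'M[C]_n) : 0 <= c -> psdmx A -> psdmx (c%:C *: A).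
Proof.
move=> c0 [/is_hermitianmxP hA pA]; split=> [|v].
  apply/is_hermitianmxP; rewrite adjmxZ conj_Creal ?ger0_real ?lecR //.
  by rewrite scalerA mulrC -scalerA -hA.
by rewrite -scalemxAr -scalemxAl mxE mulr_ge0 ?lecR.
Qed.

Lemma psdmx_gram m n (A : 'M[C]_(m, n)) : psdmx (A ^t* *m A).
Proof.
split=> [|v].
  by apply/is_hermitianmxP; rewrite expr0 scale1r adjmxM trmxCK.
rewrite mulmxA -adjmxM -mulmxA -trace_mx11 mxtrace_mulC.
exact: tr_adj_mul_ge0.
Qed.

Lemma psdmx_ketbra n (x : 'cV[C]_n) : psdmx (ketbra x).
Proof. by rewrite /ketbra -{1}[x]trmxCK; exact: psdmx_gram. Qed.

Lemma psdmx1 n : psdmx (1%:M : 'M[C]_n).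
Proof. by rewrite -[1%:M]mul1mx -{1}adjmx1; exact: psdmx_gram. Qed.

(** A self-adjoint involution satisfies [(1 + K)^2 = 2 (1 + K)], so [1 + K] is half a Gram
    matrix. *)
Lemma psdmx_addinvol n (K : 'M[C]_n) :
  K ^t* = K -> K *m K = 1%:M -> psdmx (1%:M + K).
Proof.
move=> KH KK; pose c : R := 2^-1.
have -> : 1%:M + K = c%:C *: ((1%:M + K) ^t* *m (1%:M + K)).
  rewrite adjmxD adjmx1 KH mulmxDl !mulmxDr !mul1mx mulmx1 KK.
  rewrite addrACA [1%:M + K]addrC [K + 1%:M]addrC -mulr2n -scaler_nat scalerA.
  rewrite -(rmorph_nat (real_complex R)) -rmorphM /=.
  by rewrite mulVf ?scale1r ?pnatr_eq0.
by apply: psdmxZ; [rewrite invr_ge0 | exact: psdmx_gram].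
Qed.

Lemma ketbraM m n (A : 'M[C]_(m, n)) (x : 'cV[C]_n) :
  ketbra (A *m x) = A *m ketbra x *m A ^t*.
Proof. by rewrite /ketbra adjmxM !mulmxA. Qed.

Lemma tr_mul_ketbra n (M : 'M[C]_n) (x : 'cV[C]_n) :
  \tr (M *m ketbra x) = (x ^t* *m M *m x) 0 0.
Proof. by rewrite /ketbra mulmxA mxtrace_mulC mulmxA trace_mx11. Qed.

Lemma tr_ketbra n (x : 'cV[C]_n) : \tr (ketbra x) = (x ^t* *m x) 0 0.
Proof. by rewrite -[ketbra x]mul1mx tr_mul_ketbra mulmx1. Qed.

End Psd.

(** * Bipartite vectors as matrices *)

Section Bipartite.
Context {R : realType}.
Local Notation C := R[i].

Lemma sum_mxtens (V : nmodType) m n (G : 'I_(m * n) -> V) :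
  \sum_p G p = \sum_(i < m) \sum_(j < n) G (mxtens_index (i, j)).
Proof.
rewrite pair_bigA /= (reindex (@mxtens_index m n)) /=; last first.
  exists (@mxtens_unindex m n) => p _; first exact: mxtens_indexK.
  exact: mxtens_unindexK.
by apply: eq_bigr => -[].
Qed.

Lemma tensvE m n (x : 'cV[C]_m) (y : 'cV[C]_n) i j :
  tensv x y (mxtens_index (i, j)) 0 = x i 0 * y j 0.
Proof.
rewrite /tensv mxE mxtens_indexK /=.
by congr (x _ _ * y _ _); apply: val_inj.
Qed.

(** Local operators become left and right multiplications, the inner product becomes the
    Hilbert-Schmidt one, and Schmidt rank becomes matrix rank. *)
Definition unvec m n (v : 'cV[C]_(m * n)) : 'M[C]_(m, n) :=
  \matrix_(i, j) v (mxtens_index (i, j)) 0.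

Lemma unvecB m n (u v : 'cV[C]_(m * n)) : unvec (u - v) = unvec u - unvec v.
Proof. by apply/matrixP => i j; rewrite !mxE. Qed.

Lemma unvecN m n (v : 'cV[C]_(m * n)) : unvec (- v) = - unvec v.
Proof. by apply/matrixP => i j; rewrite !mxE. Qed.

Lemma unvecZ m n c (v : 'cV[C]_(m * n)) : unvec (c *: v) = c *: unvec v.
Proof. by apply/matrixP => i j; rewrite !mxE. Qed.

Lemma unvec_sum m n I (r : seq I) (F : I -> 'cV[C]_(m * n)) :
  unvec (\sum_(i <- r) F i) = \sum_(i <- r) unvec (F i).
Proof.
apply/matrixP => i j; rewrite mxE !summxE.
by apply: eq_bigr => k _; rewrite mxE.
Qed.

Lemma unvec_inj m n : injective (@unvec m n).
Proof.
move=> u v /matrixP uv; apply/matrixP => p q; rewrite (ord1 q).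
case: (mxtens_indexP p) => i j.
by have := uv i j; rewrite !mxE.
Qed.

Lemma unvec_tensv m n (x : 'cV[C]_m) (y : 'cV[C]_n) :
  unvec (tensv x y) = x *m y^T.
Proof.
by apply/matrixP => i j; rewrite mxE tensvE mxE big_ord1 [_^T _ _]mxE.
Qed.

Lemma unvec_tensmx m n (A : 'M[C]_m) (B : 'M[C]_n) v :
  unvec ((A *t B) *m v) = A *m unvec v *m B^T.
Proof.
apply/matrixP => i j; rewrite !mxE sum_mxtens exchange_big /=.
apply: eq_bigr => l _; rewrite mxE mulr_suml; apply: eq_bigr => k _.
by rewrite tensmxE !mxE mulrAC.
Qed.

Lemma dot_unvec m n (u v : 'cV[C]_(m * n)) :
  (u ^t* *m v) 0 0 = \tr (unvec v *m (unvec u) ^t*).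
Proof.
rewrite mxE sum_mxtens; apply: eq_bigr => i _; rewrite mxE.
by apply: eq_bigr => j _; rewrite !mxE mulrC.
Qed.

(** Each Schmidt term becomes a multiple of a column times a row, of rank at most one, and rank is
    subadditive. *)
Lemma mxrank_unvec m n (v : 'cV[C]_(m * n)) r :
  has_schmidt_rank v r -> (\rank (unvec v) <= r)%N.
Proof.
move=> [s [e [f [_ _ _ ->]]]]; rewrite unvec_sum.
apply: leq_trans (mxrank_sum_le _ _) _.
rewrite -[X in (_ <= X)%N]card_ord -sum1_card; apply: leq_sum => i _.
rewrite unvecZ unvec_tensv; apply: leq_trans (mxrank_scale _ _) _.
by apply: leq_trans (mxrankM_maxl _ _) _; exact: rank_leq_col.
Qed.

End Bipartite.

(** * Algebra of the flip, [omega] and [Omega] *)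

Section FlipOmega.
Context {R : realType}.
Local Notation C := R[i].

Lemma mulmx_cV_inj m n (A B : 'M[C]_(m, n)) :
  (forall v : 'cV[C]_n, A *m v = B *m v) -> A = B.
Proof.
move=> AB; apply/matrixP => i j.
by have := AB (delta_mx j 0); rewrite -!colE => /matrixP/(_ i 0); rewrite !mxE.
Qed.

Lemma tensv_ket d (i j : 'I_d) :
  tensv (ket R i) (ket R j) = delta_mx (mxtens_index (i, j)) 0.
Proof.
apply/matrixP => p q; rewrite (ord1 q); case: (mxtens_indexP p) => k l.
by rewrite tensvE !mxE (can_eq (@mxtens_indexK d d)) !andbT -natrM mulnb.
Qed.

Lemma unvec_flip d (v : 'cV[C]_(d * d)) : unvec (flip d *m v) = (unvec v)^T.
Proof.
rewrite [RHS]matrix_sum_delta /flip mulmx_suml unvec_sum.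
apply: eq_bigr => i _; rewrite mulmx_suml unvec_sum.
apply: eq_bigr => j _.
rewrite -mulmxA [X in _ *m X]mx11_scalar mul_mx_scalar unvecZ !tensv_ket.
rewrite trmx_delta map_delta_mx -rowE !mxE; congr (_ *: _).
apply/matrixP => k l; rewrite !mxE (can_eq (@mxtens_indexK d d)).
by rewrite andbT.
Qed.

Lemma flipE d (i j k l : 'I_d) :
  (flip d : 'M[C]_(d * d)) (mxtens_index (i, j)) (mxtens_index (k, l)) =
  (i == l)%:R * (j == k)%:R.
Proof.
have := unvec_flip (delta_mx (mxtens_index (k, l)) 0 : 'cV[C]_(d * d)).
move=> /matrixP/(_ i j); rewrite -colE !mxE => ->.
by rewrite (can_eq (@mxtens_indexK d d)) andbT xpair_eqE andbC -mulnb natrM.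
Qed.

Lemma flip_flip d : flip d *m flip d = 1%:M :> 'M[C]_(d * d).
Proof.
apply: mulmx_cV_inj => v; apply: unvec_inj.
by rewrite -mulmxA !unvec_flip trmxK mul1mx.
Qed.

Lemma flip_adj d : (flip d) ^t* = flip d :> 'M[C]_(d * d).
Proof.
apply/matrixP => p q.
case: (mxtens_indexP p) => i j; case: (mxtens_indexP q) => k l.
rewrite mxE mxE !flipE rmorphM !rmorph_nat mulrC.
by congr (_%:R * _%:R); rewrite eq_sym.
Qed.

Lemma mxtrace_flip d : \tr (flip d : 'M[C]_(d * d)) = d%:R.
Proof.
rewrite /mxtrace sum_mxtens; under eq_bigr => i _.
  rewrite (bigD1 i) //= big1 ?addr0 => [|j ji]; first over.
  by rewrite flipE (negPf ji) mulr0.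
under eq_bigr do rewrite flipE eqxx mulr1.
by rewrite sumr_const card_ord.
Qed.

Lemma unvec_omega d : unvec (omega d) = (sqrtC d%:R)^-1 *: (1%:M : 'M[C]_d).
Proof.
rewrite /omega unvecZ unvec_sum; congr (_ *: _).
rewrite scalar_mx_sum_delta; apply: eq_bigr => i _.
by rewrite unvec_tensv /ket trmx_delta mul_delta_mx scale1r.
Qed.

Lemma conjC_sqrtC_natV d : ((sqrtC d%:R : C)^-1)^* = (sqrtC d%:R)^-1.
Proof. by apply: conj_Creal; rewrite ger0_real // invr_ge0 sqrtC_ge0 ler0n. Qed.

Lemma sqr_sqrtC_natV d : ((sqrtC d%:R : C)^-1) * (sqrtC d%:R)^-1 = d%:R^-1.
Proof. by rewrite -invfM -expr2 sqrtCK. Qed.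

Lemma omega_dot d (v : 'cV[C]_(d * d)) :
  ((omega d) ^t* *m v) 0 0 = (sqrtC d%:R)^-1 * \tr (unvec v).
Proof.
rewrite dot_unvec unvec_omega adjmxZ adjmx1 conjC_sqrtC_natV.
by rewrite -scalemxAr mulmx1 mxtraceZ.
Qed.

Lemma omega_omega d : (0 < d)%N -> ((omega d) ^t* *m omega d) 0 0 = 1 :> C.
Proof.
move=> d0; rewrite omega_dot unvec_omega mxtraceZ mxtrace1 mulrA.
by rewrite sqr_sqrtC_natV mulVf // pnatr_eq0 -lt0n.
Qed.

Lemma flip_omega d : flip d *m omega d = omega d :> 'cV[C]_(d * d).
Proof.
by apply: unvec_inj; rewrite unvec_flip unvec_omega linearZ /= trmx1.
Qed.

Lemma Omega_tr d : (Omega d)^T = - Omega d :> 'M[C]_d.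
Proof. by apply/matrixP => i j; rewrite !mxE opprB. Qed.

Lemma Omega_adj d : (Omega d) ^t* = - Omega d :> 'M[C]_d.
Proof.
rewrite Omega_tr; apply/matrixP => i j.
by rewrite !mxE rmorphN rmorphB !rmorph_nat.
Qed.

(** For even [d] the two identity blocks of [Omega_block] fill the matrix, and the square is
    computed blockwise. *)
Lemma Omega_sqr d : ~~ odd d -> Omega d *m Omega d = - 1%:M :> 'M[C]_d.
Proof.
move=> /even_halfK <-; rewrite -addnn Omega_block mulmx_block.
rewrite !mul0mx !mulmx0 !mul1mx !mulmx1 !addr0 !add0r.
by rewrite scalar_mx_block opp_block_mx !oppr0.
Qed.

Lemma IOmega_adj d : (IOmega d) ^t* = - IOmega d :> 'M[C]_(d * d).
Proof.
rewrite /IOmega trmx_tens map_mxT adjmx1 Omega_adj.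
by apply/matrixP => i j; rewrite !mxE mulrN.
Qed.

Lemma tensmx1 m n : (1%:M : 'M[C]_m) *t (1%:M : 'M[C]_n) = 1%:M.
Proof.
apply/matrixP => p q.
case: (mxtens_indexP p) => i j; case: (mxtens_indexP q) => k l.
by rewrite tensmxE !mxE (can_eq (@mxtens_indexK m n)) -natrM mulnb.
Qed.

Lemma IOmega_sqr d : ~~ odd d -> IOmega d *m IOmega d = - 1%:M :> 'M[C]_(d * d).
Proof.
move=> d_even; rewrite /IOmega tensmx_mul mul1mx Omega_sqr // -tensmx1.
by apply/matrixP => i j; rewrite !mxE mulrN.
Qed.

Lemma unvec_IOmega_omega d :
  unvec (IOmega d *m omega d) = - (sqrtC d%:R)^-1 *: (Omega d : 'M[C]_d).
Proof.
rewrite unvec_tensmx unvec_omega mul1mx -scalemxAl mul1mx Omega_tr.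
by rewrite scalerN scaleNr.
Qed.

(** The matrix of this vector is a multiple of the antisymmetric [Omega], and the flip transposes
    it. *)
Lemma flip_IOmega_omega d :
  flip d *m (IOmega d *m omega d) = - (IOmega d *m omega d) :> 'cV[C]_(d * d).
Proof.
apply: unvec_inj; rewrite unvec_flip unvecN unvec_IOmega_omega.
by rewrite linearZ /= Omega_tr scalerN.
Qed.

End FlipOmega.

(** * The Schmidt number witness *)

Section Witness.
Context {R : realType}.
Local Notation C := R[i].

(* The omega' and F' of the introduction. *)
Definition omegaO d : 'cV[C]_(d * d) := IOmega d *m omega d.

Definition flipO d : 'M[C]_(d * d) := IOmega d *m flip d *m (IOmega d) ^t*.

Lemma ketbra_omegaO d :
  ketbra (omegaO d) = IOmega d *m ketbra (omega d) *m (IOmega d) ^t*.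
Proof. exact: ketbraM. Qed.

Lemma IOmega_adjK d :
  ~~ odd d -> (IOmega d) ^t* *m IOmega d = 1%:M :> 'M[C]_(d * d).
Proof. by move=> ?; rewrite IOmega_adj mulNmx IOmega_sqr // opprK. Qed.

Lemma flipO_adj d : (flipO d) ^t* = flipO d.
Proof. by rewrite /flipO !adjmxM trmxCK flip_adj mulmxA. Qed.

Lemma flipO_sqr d : ~~ odd d -> flipO d *m flipO d = 1%:M.
Proof.
move=> d_even; rewrite /flipO !mulmxA -[_ *m _ *m IOmega d]mulmxA.
rewrite IOmega_adjK // mulmx1 -[_ *m flip d *m flip d]mulmxA flip_flip mulmx1.
by rewrite IOmega_adj mulmxN IOmega_sqr // opprK.
Qed.

Lemma mxtrace_flipO d : ~~ odd d -> \tr (flipO d) = d%:R.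
Proof.
move=> d_even; rewrite /flipO mxtrace_mulC mulmxA IOmega_adjK // mul1mx.
exact: mxtrace_flip.
Qed.

(** Three signs multiply: from the adjoint of [IOmega], from the antisymmetry of omega' under the
    flip, and from the square of [IOmega]. *)
Lemma flipO_omega d : ~~ odd d -> flipO d *m omega d = - omega d.
Proof.
move=> d_even; rewrite /flipO -!mulmxA IOmega_adj mulNmx mulmxN.
by rewrite flip_IOmega_omega opprK mulmxA IOmega_sqr // mulNmx mul1mx.
Qed.

Lemma flipO_omegaO d : ~~ odd d -> flipO d *m omegaO d = omegaO d.
Proof.
move=> d_even; rewrite /flipO /omegaO -!mulmxA.
by rewrite [_ ^t* *m _]mulmxA IOmega_adjK // mul1mx flip_omega.
Qed.

Lemma omegaO_omegaO d : ~~ odd d -> (0 < d)%N ->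
  ((omegaO d) ^t* *m omegaO d) 0 0 = 1.
Proof.
move=> d_even d0; rewrite /omegaO adjmxM mulmxA -[_ *m _ *m IOmega d]mulmxA.
by rewrite IOmega_adjK // mulmx1 omega_omega.
Qed.

Lemma omega_omegaO d : ((omega d) ^t* *m omegaO d) 0 0 = 0.
Proof.
rewrite omega_dot unvec_IOmega_omega mxtraceZ.
rewrite (_ : \tr (Omega d) = 0) ?mulr0 // /mxtrace big1 // => i _.
by rewrite mxE subrr.
Qed.

(** On matrices [flipO] is a transposition combined with multiplications by fixed matrices, none of
    which raises the rank. *)
Lemma mxrank_unvec_flipO d (v : 'cV[C]_(d * d)) :
  (\rank (unvec (flipO d *m v)) <= \rank (unvec v))%N.
Proof.
rewrite /flipO -!mulmxA /IOmega unvec_tensmx unvec_flip mul1mx.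
apply: leq_trans (mxrankM_maxl _ _) _.
rewrite mxrank_tr trmx_tens map_mxT adjmx1 unvec_tensmx mul1mx.
exact: mxrankM_maxl.
Qed.

Definition witness k d : 'M[C]_(d * d) :=
  k%:R *: 1%:M - d%:R *: ketbra (omega d) - k%:R *: flipO d.

Lemma witness_form k d (v : 'cV[C]_(d * d)) :
  (v ^t* *m witness k d *m v) 0 0 =
  k%:R * (v ^t* *m v) 0 0 - d%:R * `|((omega d) ^t* *m v) 0 0| ^+ 2
  - k%:R * (v ^t* *m flipO d *m v) 0 0.
Proof.
rewrite /witness; move: (flipO d) (omega d) => F w.
rewrite !mulmxBr !mulmxBl -!scalemxAr -!scalemxAl mulmx1.
rewrite -[_ *m ketbra _ *m v]mulmxA /ketbra -[_ *m _ *m v]mulmxA mulmxA.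
have -> : v ^t* *m w = (w ^t* *m v) ^t* by rewrite adjmxM trmxCK.
move: (v ^t* *m v) (w ^t* *m v) (v ^t* *m F *m v) => x y z.
by rewrite !mxE big_ord1 !mxE normCK [_^* * _]mulrC.
Qed.

(* For [u = v - flipO v] the matrix [unvec u] has rank at most [2k], and
   [\tr (unvec u)] and [`|u|^2] are, up to constants, the two halves of the
   witness at [v]. *)
Lemma witness_ge0 k d (v : 'cV[C]_(d * d)) : ~~ odd d -> (0 < d)%N ->
  (\rank (unvec v) <= k)%N -> 0 <= (v ^t* *m witness k d *m v) 0 0.
Proof.
move=> d_even d0 rkv; rewrite witness_form.
pose u := v - flipO d *m v.
have uu : (u ^t* *m u) 0 0 =
    2 * ((v ^t* *m v) 0 0 - (v ^t* *m flipO d *m v) 0 0).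
  rewrite /u adjmxB adjmxM flipO_adj mulmxBl !mulmxBr.
  have -> : v ^t* *m flipO d *m (flipO d *m v) = v ^t* *m v.
    by rewrite mulmxA -[_ *m flipO d *m flipO d]mulmxA flipO_sqr // mulmx1.
  rewrite -mulmxA !mxE; ring.
have ou : ((omega d) ^t* *m u) 0 0 = 2 * ((omega d) ^t* *m v) 0 0.
  rewrite /u mulmxBr mulmxA -[flipO d]flipO_adj -adjmxM flipO_omega //.
  rewrite linearN map_mxN mulNmx !mxE; ring.
have rku : (\rank (unvec u) <= 2 * k)%N.
  rewrite /u unvecB; apply: leq_trans (mxrank_add _ _) _.
  rewrite mxrank_opp mul2n -addnn leq_add //.
  exact: leq_trans (mxrank_unvec_flipO _) rkv.
(* The overlap with [omega] is [\tr (unvec u)] over the square root of [d], so the left side is the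
   squared modulus of that trace. *)
have key : d%:R * `|((omega d) ^t* *m u) 0 0| ^+ 2 <=
    (2 * k)%:R * (u ^t* *m u) 0 0.
  rewrite omega_dot normrM exprMn.
  rewrite -normrX expr2 sqr_sqrtC_natV normfV normr_nat.
  rewrite mulVKf ?pnatr_eq0 -?lt0n //.
  rewrite dot_unvec; apply: le_trans (norm_mxtrace_le_rank _) _.
  by rewrite ler_wpM2r ?tr_adj_mul_ge0 // ler_nat.
(* The factor 4 matches [key]: squaring the 2 in [ou] gives 4 on one side, and [2 * k] times the 2
   in [uu] gives [4 k] on the other. *)
rewrite -(pmulr_rge0 _ (ltr0n C 4)).
move: key; rewrite -subr_ge0 ou uu normrM exprMn normr_nat natrM.
set x := _ 0 0; set y := _ 0 0; set z := _ 0 0 => key.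
by apply: le_trans key _; rewrite le_eqVlt; apply/orP; left; apply/eqP; ring.
Qed.

Lemma tr_witness_ge0 k d (rho : 'M[C]_(d * d)) :
  ~~ odd d -> (0 < d)%N -> schmidt_number_le rho k ->
  0 <= \tr (witness k d *m rho).
Proof.
move=> d_even d0 [N [p [xi [p0 _ _ rk ->]]]].
rewrite mulmx_sumr raddf_sum; apply: sumr_ge0 => i _ /=.
rewrite -scalemxAr mxtraceZ tr_mul_ketbra mulr_ge0 ?lecR //.
have [r rkr rk_le] := rk i; apply: witness_ge0 => //.
exact: leq_trans (mxrank_unvec rkr) rk_le.
Qed.

End Witness.

(** * Partial transposes of the building blocks *)

Section PartialTranspose.
Context {R : realType}.
Local Notation C := R[i].

Lemma ptransD m n (A B : 'M[C]_(m * n)) : ptrans (A + B) = ptrans A + ptrans B.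
Proof. by apply/matrixP => p q; rewrite !mxE. Qed.

Lemma ptransZ m n c (A : 'M[C]_(m * n)) : ptrans (c *: A) = c *: ptrans A.
Proof. by apply/matrixP => p q; rewrite !mxE. Qed.

Lemma ptransK m n : involutive (@ptrans R m n).
Proof.
move=> A; apply/matrixP => p q.
case: (mxtens_indexP p) => i j; case: (mxtens_indexP q) => k l.
by rewrite !mxE !mxtens_indexK.
Qed.

Lemma tens1mxE m n p (A : 'M[C]_n) (M : 'M[C]_(m * n, p)) i j q :
  ((1%:M *t A) *m M) (mxtens_index (i, j)) q =
  \sum_s A j s * M (mxtens_index (i, s)) q.
Proof.
rewrite mxE sum_mxtens (bigD1 i) //= [X in _ + X]big1 ?addr0 => [|k ki].
  by apply: eq_bigr => s _; rewrite tensmxE mxE eqxx mul1r.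
by rewrite big1 // => s _; rewrite tensmxE mxE eq_sym (negPf ki) !mul0r.
Qed.

Lemma mxtens1E m n p (B : 'M[C]_n) (M : 'M[C]_(p, m * n)) q k l :
  (M *m (1%:M *t B)) q (mxtens_index (k, l)) =
  \sum_t M q (mxtens_index (k, t)) * B t l.
Proof.
rewrite mxE sum_mxtens (bigD1 k) //= [X in _ + X]big1 ?addr0 => [|i ik].
  by apply: eq_bigr => t _; rewrite tensmxE mxE eqxx mul1r.
by rewrite big1 // => t _; rewrite tensmxE mxE (negPf ik) mul0r mulr0.
Qed.

Lemma ptrans_tens1mx m n (A B : 'M[C]_n) (M : 'M[C]_(m * n)) :
  ptrans ((1%:M *t A) *m M *m (1%:M *t B)) =
  (1%:M *t B^T) *m ptrans M *m (1%:M *t A^T).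
Proof.
apply/matrixP => p q.
case: (mxtens_indexP p) => i j; case: (mxtens_indexP q) => k l.
rewrite mxE !mxtens_indexK /= !mxtens1E.
under eq_bigr do rewrite tens1mxE mulr_suml.
under [RHS]eq_bigr do rewrite tens1mxE mulr_suml.
rewrite exchange_big /=; apply: eq_bigr => s _; apply: eq_bigr => t _.
rewrite !mxE !mxtens_indexK /=; ring.
Qed.

(** Both sides have entry [(i == l) (j == k) / d] at row [(i, j)] and column [(k, l)]. *)
Lemma ptrans_ketbra_omega d :
  ptrans (ketbra (omega d)) = d%:R^-1 *: flip d :> 'M[C]_(d * d).
Proof.
have omE i j : omega d (mxtens_index (i, j)) 0 =
    (sqrtC d%:R)^-1 * (i == j)%:R :> C.
  by have /matrixP/(_ i j) := @unvec_omega R d; rewrite !mxE.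
apply/matrixP => p q.
case: (mxtens_indexP p) => i j; case: (mxtens_indexP q) => k l.
rewrite [LHS]mxE !mxtens_indexK /= [RHS]mxE flipE /ketbra [LHS]mxE big_ord1.
rewrite adjmxE !omE.
rewrite rmorphM rmorph_nat /= conjC_sqrtC_natV mulrACA sqr_sqrtC_natV.
by rewrite [k == j]eq_sym.
Qed.

Lemma IOmega_tens d : (IOmega d) ^t* = 1%:M *t (Omega d)^T :> 'M[C]_(d * d).
Proof. by rewrite /IOmega trmx_tens map_mxT adjmx1 Omega_adj Omega_tr. Qed.

(** [Omega] is real, so its adjoint is its transpose; moving both factors across and transposing
    them restores the same conjugation. *)
Lemma ptrans_IOmega d (M : 'M[C]_(d * d)) :
  ptrans (IOmega d *m M *m (IOmega d) ^t*) =
  IOmega d *m ptrans M *m (IOmega d) ^t*.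
Proof. by rewrite IOmega_tens ptrans_tens1mx trmxK. Qed.

Lemma ptrans_flipO d : (0 < d)%N ->
  ptrans (flipO d) = d%:R *: ketbra (omegaO d) :> 'M[C]_(d * d).
Proof.
move=> d0; rewrite ketbra_omegaO ptrans_IOmega.
have -> : flip d = d%:R *: ptrans (ketbra (omega d)) :> 'M[C]_(d * d).
  by rewrite ptrans_ketbra_omega scalerA divff ?scale1r // pnatr_eq0 -lt0n.
by rewrite ptransZ ptransK -scalemxAr -scalemxAl.
Qed.

Lemma ptrans_ketbra_omegaO d :
  ptrans (ketbra (omegaO d)) = d%:R^-1 *: flipO d :> 'M[C]_(d * d).
Proof.
rewrite ketbra_omegaO ptrans_IOmega ptrans_ketbra_omega.
by rewrite -scalemxAr -scalemxAl.
Qed.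

Lemma ptrans1 m n : ptrans (1%:M : 'M[C]_(m * n)) = 1%:M.
Proof. by rewrite -tensmx1 ptransE trmx1. Qed.

End PartialTranspose.

(** * Explicit decompositions into vectors of bounded Schmidt rank *)

Section SchmidtCone.
Context {R : realType}.
Local Notation C := R[i].

(** The unnormalised form of [schmidt_number_le]: with free total weight the set is closed under
    sums and nonnegative scaling, and lists make sums a concatenation. *)
Definition schmidt_cone m n (k : nat) (rho : 'M[C]_(m * n)) : Prop :=
  exists2 s : seq (R * 'cV[C]_(m * n)),
    forall x, x \in s ->
      [/\ 0 <= x.1, (x.2 ^t* *m x.2) 0 0 = 1 &
          exists2 r, has_schmidt_rank x.2 r & (r <= k)%N] &
    rho = \sum_(x <- s) x.1%:C *: ketbra x.2.

Lemma schmidt_coneD m n k (A B : 'M[C]_(m * n)) :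
  schmidt_cone k A -> schmidt_cone k B -> schmidt_cone k (A + B).
Proof.
move=> [s sP ->] [t tP ->]; exists (s ++ t); last by rewrite big_cat.
by move=> x; rewrite mem_cat => /orP[/sP|/tP].
Qed.

Lemma schmidt_coneZ m n k c (A : 'M[C]_(m * n)) :
  0 <= c -> schmidt_cone k A -> schmidt_cone k (c%:C *: A).
Proof.
move=> c0 [s sP ->]; exists [seq (c * x.1, x.2) | x <- s].
  by move=> _ /mapP[x /sP[x0 xn xr] ->]; split => //=; exact: mulr_ge0.
rewrite big_map scaler_sumr; apply: eq_bigr => x _.
by rewrite scalerA -rmorphM.
Qed.

Lemma schmidt_cone_sum m n k I (r : seq I) (P : pred I)
    (F : I -> 'M[C]_(m * n)) :
  (forall i, P i -> schmidt_cone k (F i)) ->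
  schmidt_cone k (\sum_(i <- r | P i) F i).
Proof.
move=> FP; apply: (big_ind (schmidt_cone k)) => //.
- by exists [::] => //; rewrite big_nil.
- by move=> A B; exact: schmidt_coneD.
Qed.

(** The vectors are unit vectors, so the trace of [rho] is the total weight. *)
Lemma schmidt_cone_number_le m n k (rho : 'M[C]_(m * n)) :
  schmidt_cone k rho -> \tr rho = 1 -> schmidt_number_le rho k.
Proof.
move=> [s sP rhoE] tr1.
exists (size s), (fun i => (tnth (in_tuple s) i).1),
  (fun i => (tnth (in_tuple s) i).2).
have sP' i : [/\ 0 <= (tnth (in_tuple s) i).1,
    ((tnth (in_tuple s) i).2 ^t* *m (tnth (in_tuple s) i).2) 0 0 = 1 &
    exists2 r, has_schmidt_rank (tnth (in_tuple s) i).2 r & (r <= k)%N].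
  by apply: sP; rewrite mem_tnth.
split=> [i||i|i|]; try by case: (sP' i).
- apply: (fmorph_inj (real_complex R)).
  rewrite rmorph_sum rmorph1 -[RHS]tr1 rhoE raddf_sum.
  rewrite [RHS](big_tnth _ _ s); apply: eq_bigr => i _ /=.
  by rewrite mxtraceZ tr_ketbra; case: (sP' i) => _ -> _; rewrite mulr1.
- by rewrite rhoE (big_tnth _ _ s).
Qed.

Lemma dot_tensv m n (x x' : 'cV[C]_m) (y y' : 'cV[C]_n) :
  ((tensv x y) ^t* *m tensv x' y') 0 0 =
  (x ^t* *m x') 0 0 * (y ^t* *m y') 0 0.
Proof.
rewrite mxE sum_mxtens !mxE mulr_suml; apply: eq_bigr => i _.
rewrite mulr_sumr; apply: eq_bigr => j _.
by rewrite mxE mxE !tensvE !mxE rmorphM mulrACA.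
Qed.

(** The sum has squared norm [r]; normalising it gives one unit vector of weight [r] with all
    Schmidt coefficients equal to [c^-1], the inverse square root of [r]. *)
Lemma schmidt_cone_entangled m n r
    (e : 'I_r -> 'cV[C]_m) (f : 'I_r -> 'cV[C]_n) :
  (0 < r)%N -> orthonormal_family e -> orthonormal_family f ->
  schmidt_cone r (ketbra (\sum_i tensv (e i) (f i))).
Proof.
move=> r0 eo fo; set v := \sum_i _.
pose c : R := Num.sqrt r%:R.
have c0 : 0 < c by rewrite sqrtr_gt0 ltr0n.
have cE : c * c = r%:R by rewrite -expr2 sqr_sqrtr.
have cV : (c^-1)%:C^* = (c^-1)%:C :> C.
  by rewrite conj_Creal // ger0_real // lecR invr_ge0 ltW.
have vv : (v ^t* *m v) 0 0 = r%:R.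
  rewrite /v adjmx_sum mulmx_suml summxE.
  transitivity (\sum_(i < r) (1 : C)); last by rewrite sumr_const card_ord.
  apply: eq_bigr => i _; rewrite mulmx_sumr summxE (bigD1 i) //= big1 ?addr0.
    by rewrite dot_tensv eo fo eqxx mulr1.
  by move=> j ji; rewrite dot_tensv eo eq_sym (negPf ji) mul0r.
exists [:: (r%:R, (c^-1)%:C *: v)].
  move=> x; rewrite inE => /eqP -> /=; split; first exact: ler0n.
    rewrite adjmxZ cV -scalemxAr -scalemxAl scalerA mxE vv.
    rewrite -(rmorph_nat (real_complex R)) -!rmorphM -invfM cE /=.
    by rewrite mulVf ?pnatr_eq0 -?lt0n.
  exists r => //; exists (fun=> c^-1), e, f; split=> //.
    by move=> i; rewrite invr_gt0.
  by rewrite scaler_sumr.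
rewrite big_seq1 /= /ketbra adjmxZ cV -scalemxAr -scalemxAl !scalerA.
by rewrite -!rmorphM -?mulrA -invfM cE divff ?scale1r ?pnatr_eq0 -?lt0n.
Qed.

Lemma schmidt_cone_le m n k l (A : 'M[C]_(m * n)) :
  (k <= l)%N -> schmidt_cone k A -> schmidt_cone l A.
Proof.
move=> kl [s sP AE]; exists s => // x /sP[x0 x1 [r xr rk]]; split => //.
by exists r => //; exact: leq_trans kl.
Qed.

Lemma orthonormal_ket r d (V : 'M[C]_d) (g : 'I_r -> 'I_d) :
  V ^t* *m V = 1%:M -> injective g ->
  orthonormal_family (fun i => V *m ket R (g i)).
Proof.
move=> VV gi i j; rewrite adjmxM -mulmxA [V ^t* *m _]mulmxA VV mul1mx.
rewrite trmx_delta map_delta_mx mul_delta_mx_cond (inj_eq gi).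
by case: (i == j); rewrite ?mulr1n ?mulr0n !mxE.
Qed.

Lemma tens1mx_tensv m n (V : 'M[C]_n) (x : 'cV[C]_m) y :
  (1%:M *t V) *m tensv x y = tensv x (V *m y).
Proof.
apply: unvec_inj.
by rewrite unvec_tensmx !unvec_tensv mul1mx trmx_mul mulmxA.
Qed.

(** The common source of all pieces: [r = d] for [omega] and omega', [r = 1] for product kets,
    [r = 2] for symmetrised pairs of kets. *)
Lemma schmidt_cone_kets r d (V : 'M[C]_d) (g h : 'I_r -> 'I_d) :
  (0 < r)%N -> V ^t* *m V = 1%:M -> injective g -> injective h ->
  schmidt_cone r
    (ketbra ((1%:M *t V) *m \sum_i tensv (ket R (g i)) (ket R (h i)))).
Proof.
move=> r0 VV gi hi; rewrite mulmx_sumr.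
under eq_bigr do rewrite tens1mx_tensv.
apply: schmidt_cone_entangled => //; last exact: orthonormal_ket.
have := @orthonormal_ket r d 1%:M g.
rewrite adjmx1 mul1mx => /(_ erefl gi) go i j.
by have := go i j; rewrite !mul1mx.
Qed.

Lemma schmidt_cone_omega d (V : 'M[C]_d) : (0 < d)%N ->
  V ^t* *m V = 1%:M -> schmidt_cone d (ketbra ((1%:M *t V) *m omega d)).
Proof.
move=> d0 VV; rewrite /omega -scalemxAr /ketbra adjmxZ conjC_sqrtC_natV.
rewrite -scalemxAr -scalemxAl scalerA sqr_sqrtC_natV.
rewrite -(rmorph_nat (real_complex R)) -fmorphV.
apply: schmidt_coneZ; first by rewrite invr_ge0 ler0n.
by apply: (@schmidt_cone_kets d d V id id).
Qed.

Lemma mx1_sum_ketbra d : (1%:M : 'M[C]_(d * d)) =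
  \sum_(i < d) \sum_(j < d) ketbra (tensv (ket R i) (ket R j)).
Proof.
rewrite scalar_mx_sum_delta sum_mxtens.
apply: eq_bigr => i _; apply: eq_bigr => j _.
by rewrite scale1r tensv_ket /ketbra trmx_delta map_delta_mx mul_delta_mx.
Qed.

Lemma schmidt_cone1 d : schmidt_cone 1 (1%:M : 'M[C]_(d * d)).
Proof.
rewrite mx1_sum_ketbra; apply: schmidt_cone_sum => i _.
apply: schmidt_cone_sum => j _.
have := @schmidt_cone_kets 1 d 1%:M (fun=> i) (fun=> j).
rewrite adjmx1 mul1mx tensmx1 mul1mx big_ord1.
by apply=> //; move=> p q _; rewrite !ord1.
Qed.

(** Each ketbra expands into four terms, which pair up after exchanging [i] and [j]. For product
    kets the right side is twice identity plus flip. *)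
Lemma sum_ketbra_sym n r (t : 'I_r -> 'I_r -> 'cV[C]_n) :
  \sum_i \sum_j ketbra (t i j + t j i) =
  (\sum_i \sum_j ketbra (t i j) + \sum_i \sum_j t i j *m (t j i) ^t*) *+ 2.
Proof.
pose G i j := ketbra (t i j) + t i j *m (t j i) ^t*.
have -> : \sum_i \sum_j ketbra (t i j + t j i) =
    \sum_i \sum_j G i j + \sum_i \sum_j G j i.
  rewrite -big_split; apply: eq_bigr => i _ /=.
  rewrite -big_split; apply: eq_bigr => j _ /=.
  rewrite /G /ketbra; move: (t i j) (t j i) => x y.
  rewrite adjmxD mulmxDl !mulmxDr -!addrA; congr (_ + (_ + _)).
  exact: addrC.
rewrite [X in _ + X]exchange_big -mulr2n /=; congr (_ *+ 2).
by rewrite -big_split; apply: eq_bigr => i _; rewrite -big_split.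
Qed.

Lemma schmidt_cone_flip d (V : 'M[C]_d) : V ^t* *m V = 1%:M ->
  schmidt_cone 2 ((1%:M *t V) *m (1%:M + flip d) *m (1%:M *t V) ^t*).
Proof.
move=> VV; set U := 1%:M *t V.
pose t (i j : 'I_d) : 'cV[C]_(d * d) := tensv (ket R i) (ket R j).
have -> : 1%:M + flip d =
    (2^-1)%:C *: \sum_i \sum_j ketbra (t i j + t j i).
  rewrite sum_ketbra_sym -mx1_sum_ketbra -/(flip d).
  move: (1%:M + flip d) => X.
  rewrite -[X *+ 2]scaler_nat scalerA -(rmorph_nat (real_complex R)) -rmorphM.
  by rewrite mulVf ?pnatr_eq0 // scale1r.
rewrite -scalemxAr -scalemxAl; apply: schmidt_coneZ; first by rewrite invr_ge0.
rewrite mulmx_sumr mulmx_suml; apply: schmidt_cone_sum => i _.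
rewrite mulmx_sumr mulmx_suml; apply: schmidt_cone_sum => j _.
rewrite -ketbraM.
have [<-|ij] := eqVneq i j.
  have -> : t i i + t i i = (2%:R : R)%:C *: t i i.
    by rewrite rmorph_nat scaler_nat mulr2n.
  rewrite -scalemxAr /ketbra adjmxZ conj_Creal ?ger0_real ?lecR ?ler0n //.
  rewrite -scalemxAr -scalemxAl.
  (* The diagonal vector is twice a product ket, and the 2 comes out of the ketbra once from each
     side. *)
  do 2!(apply: schmidt_coneZ; first exact: ler0n).
  apply: (@schmidt_cone_le _ _ 1) => //.
  have := @schmidt_cone_kets 1 d V (fun=> i) (fun=> i).
  by rewrite big_ord1; apply=> //; move=> p q _; rewrite !ord1.
(* Off the diagonal the symmetrised vector is already in Schmidt form: the first factors run through
   [i, j] and the second through [j, i]. *)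
have := @schmidt_cone_kets 2 d V (fun x => if x == 0 then i else j)
  (fun x => if x == 0 then j else i).
have inj2 (a b : 'I_d) : a != b ->
    injective (fun x : 'I_2 => if x == 0 then a else b).
  move=> ab x y; case: eqP => [->|/eqP x0]; case: eqP => [->|/eqP y0] // E.
  - by rewrite E eqxx in ab.
  - by rewrite E eqxx in ab.
  - by apply: val_inj; case: x x0 {E} => -[|[|]] //; case: y y0 => -[|[|]].
rewrite big_ord_recl big_ord1 /=; apply=> //; apply: inj2 => //.
by rewrite eq_sym.
Qed.

End SchmidtCone.

(** * Decompositions of [rho_AB] and its witness value *)

Section State.
Context {R : realType}.
Local Notation C := R[i].

Lemma rho_ABE d (a b eps : R) : rho_AB d a b eps =
  (1 - eps)%:C *: (((1 - a - b) / d%:R ^+ 2)%:C *: 1%:M +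
    a%:C *: ketbra (omega d) + (b / d%:R)%:C *: flipO d) +
  eps%:C *: ketbra (omegaO d).
Proof. by rewrite /rho_AB /rho_ab tensmx1 ketbra_omegaO. Qed.

(** Completing [flipO] to [1 + flipO] costs [b / d] of the identity; the inequality
    [a + (1 + d) b <= 1] keeps what remains nonnegative. *)
Lemma rho_AB_sum d (a b eps : R) : (0 < d)%N -> rho_AB d a b eps =
  ((1 - eps) * ((1 - a - (1 + d%:R) * b) / d%:R ^+ 2))%:C *: 1%:M +
  ((1 - eps) * a)%:C *: ketbra (omega d) +
  ((1 - eps) * (b / d%:R))%:C *: (1%:M + flipO d) +
  eps%:C *: ketbra (omegaO d).
Proof.
move=> d0; have dn0 : d%:R != 0 :> R by rewrite pnatr_eq0 -lt0n.
have dn0' : d%:R != 0 :> C by rewrite pnatr_eq0 -lt0n.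
rewrite rho_ABE.
move: (ketbra (omega d)) (flipO d) (ketbra (omegaO d)) => K F L.
apply/matrixP => p q; rewrite !mxE.
rewrite !(rmorphM, rmorphD, rmorphB, rmorph1, rmorphXn, fmorphV, rmorph_nat) /=.
by field.
Qed.

(** Partial transposition exchanges [omega] with the flip and [flipO] with omega'. The perturbation
    becomes [eps / d] times [flipO], whose completion costs the identity the term [eps * d]. *)
Lemma ptrans_rho_AB_sum d (a b eps : R) : (0 < d)%N ->
  ptrans (rho_AB d a b eps) =
  (((1 - eps) * (1 - (1 + d%:R) * a - b) - eps * d%:R) / d%:R ^+ 2)%:C *: 1%:M +
  ((1 - eps) * (a / d%:R))%:C *: (1%:M + flip d) +
  ((1 - eps) * b)%:C *: ketbra (omegaO d) +
  (eps / d%:R)%:C *: (1%:M + flipO d).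
Proof.
move=> d0; have dn0 : d%:R != 0 :> R by rewrite pnatr_eq0 -lt0n.
have dn0' : d%:R != 0 :> C by rewrite pnatr_eq0 -lt0n.
rewrite rho_ABE !(ptransD, ptransZ) ptrans1.
have := @ptrans_ketbra_omega R d; have := @ptrans_flipO R d d0.
have := @ptrans_ketbra_omegaO R d.
move: (ketbra (omega d)) (flipO d) (ketbra (omegaO d)) (flip d).
move=> K F L G -> -> ->.
apply/matrixP => p q; rewrite [LHS]mxE [X in X + _ = _]mxE [RHS]mxE !mxE.
rewrite !(rmorphM, rmorphD, rmorphB, rmorph1, rmorphXn, fmorphV, rmorph_nat) /=.
by field.
Qed.

(** With [k = (d - 2) / 2] the witness has trace [d^2 (d - 3) / 2], expectation [-2] at [omega], and
    trace [- d^2 (d - 3) / 2] against [flipO]. *)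
Lemma tr_witness_rho_AB k d (a b eps : R) :
  (2 * k + 2)%N = d -> ~~ odd d ->
  \tr (witness k d *m rho_AB d a b eps) =
  ((1 - eps) * ((d%:R - 3) / 2 * (1 - a - b - b * d%:R) - 2 * a))%:C.
Proof.
move=> dE d_even; have d0 : (0 < d)%N by rewrite -dE addn2.
have dn0 : d%:R != 0 :> C by rewrite pnatr_eq0 -lt0n.
have kE : k%:R = (d%:R - 2) / 2 :> C.
  by rewrite -dE natrD natrM addrK mulrC mulKf ?pnatr_eq0.
have t1 : \tr (witness k d) = k%:R * d%:R ^+ 2 - d%:R - k%:R * d%:R :> C.
  rewrite /witness !mxtraceB !mxtraceZ mxtrace1 tr_ketbra omega_omega //.
  by rewrite mxtrace_flipO // natrM mulr1.
have t2 : \tr (witness k d *m ketbra (omega d)) =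
    k%:R - d%:R + k%:R :> C.
  rewrite tr_mul_ketbra witness_form omega_omega // normr1 -mulmxA.
  rewrite flipO_omega // mulmxN [X in _ - _ * X]mxE omega_omega //; ring.
have t3 : \tr (witness k d *m flipO d) =
    k%:R * d%:R + d%:R - k%:R * d%:R ^+ 2 :> C.
  rewrite /witness !mulmxBl -!scalemxAl mul1mx flipO_sqr // !mxtraceB.
  rewrite !mxtraceZ mxtrace_flipO // mxtrace1 mxtrace_mulC tr_mul_ketbra.
  rewrite -mulmxA flipO_omega // mulmxN [X in _ - _ * X - _]mxE omega_omega //.
  rewrite natrM; ring.
(* omega' is orthogonal to [omega] and fixed by [flipO], so only [k - k] remains. *)
have t4 : \tr (witness k d *m ketbra (omegaO d)) = 0 :> C.
  rewrite tr_mul_ketbra witness_form omegaO_omegaO // omega_omegaO normr0.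
  rewrite -mulmxA flipO_omegaO // omegaO_omegaO //; ring.
rewrite rho_ABE !mulmxDr -!scalemxAr !mulmxDr -!scalemxAr mulmx1.
rewrite !mxtraceD !mxtraceZ !mxtraceD !mxtraceZ t1 t2 t3 t4 kE.
rewrite !(rmorphM, rmorphD, rmorphB, rmorph1, rmorphXn, fmorphV, rmorph_nat) /=.
by field.
Qed.

Lemma tr_rho_AB d (a b eps : R) : ~~ odd d -> (0 < d)%N ->
  \tr (rho_AB d a b eps) = 1.
Proof.
move=> d_even d0; have dn0 : d%:R != 0 :> C by rewrite pnatr_eq0 -lt0n.
rewrite rho_ABE !(mxtraceD, mxtraceZ).
rewrite mxtrace1 natrM !tr_ketbra omega_omega // omegaO_omegaO //.
rewrite mxtrace_flipO //.
rewrite !(rmorphM, rmorphD, rmorphB, rmorph1, rmorphXn, fmorphV) /=.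
rewrite !rmorph_nat.
by field.
Qed.

(** A nonempty set of naturals has a minimum, so [xget] does not fall back on its default 0. *)
Lemma schmidt_number_attained m n (rho : 'M[C]_(m * n)) k :
  schmidt_number_le rho k -> schmidt_number_le rho (schmidt_number rho).
Proof.
move=> rk; rewrite /schmidt_number; case: xgetP => [j _ []//|none].
have ex : exists k, `[< schmidt_number_le rho k >] by exists k; exact/asboolP.
case: (ex_minnP ex) => j /asboolP rj jmin; case: (none j); split=> // l rl.
by apply: jmin; exact/asboolP.
Qed.

Lemma schmidt_cone_rho_AB d (a b eps : R) : ~~ odd d -> (1 < d)%N ->
  0 <= a -> 0 <= b -> a + (1 + d%:R) * b <= 1 -> 0 <= eps <= 1 ->
  schmidt_cone d (rho_AB d a b eps).
Proof.
move=> d_even d1 a0 b0 ab1 /andP[e0 e1].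
have d0 := ltnW d1; have dR0 : 0 <= d%:R :> R := ler0n _ _.
have e1' : 0 <= 1 - eps by lra.
have OO : (Omega d) ^t* *m Omega d = 1%:M :> 'M[C]_d.
  by rewrite Omega_adj mulNmx Omega_sqr // opprK.
rewrite rho_AB_sum //.
apply: schmidt_coneD; [apply: schmidt_coneD; [apply: schmidt_coneD|]|].
- apply: schmidt_coneZ; last exact/(schmidt_cone_le d0)/schmidt_cone1.
  by rewrite mulr_ge0 // divr_ge0 ?exprn_ge0 //; lra.
- apply: schmidt_coneZ; first exact: mulr_ge0.
  have := @schmidt_cone_omega R d 1%:M d0.
  by rewrite adjmx1 mul1mx tensmx1 mul1mx; apply.
- apply: schmidt_coneZ; first by rewrite mulr_ge0 // divr_ge0.
  apply: (schmidt_cone_le d1).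
  have := schmidt_cone_flip OO; rewrite -/(IOmega d) mulmxDr mulmxDl mulmx1.
  by rewrite IOmega_adj mulmxN IOmega_sqr // opprK /flipO IOmega_adj.
- by apply: schmidt_coneZ => //; exact: schmidt_cone_omega.
Qed.

Lemma psdmx_rho_AB d (a b eps : R) : ~~ odd d -> (0 < d)%N ->
  0 <= a -> 0 <= b -> a + (1 + d%:R) * b <= 1 -> 0 <= eps <= 1 ->
  psdmx (rho_AB d a b eps).
Proof.
move=> d_even d0 a0 b0 ab1 /andP[e0 e1].
have dR0 : 0 <= d%:R :> R := ler0n _ _.
have e1' : 0 <= 1 - eps by lra.
rewrite rho_AB_sum //; apply: psdmxD; [apply: psdmxD; [apply: psdmxD|]|].
- apply: psdmxZ (psdmx1 _).
  by rewrite mulr_ge0 // divr_ge0 ?exprn_ge0 //; lra.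
- by apply: psdmxZ (psdmx_ketbra _); exact: mulr_ge0.
- apply: psdmxZ; first by rewrite mulr_ge0 // divr_ge0.
  exact: psdmx_addinvol (flipO_adj _) (flipO_sqr d_even).
- exact: psdmxZ (psdmx_ketbra _).
Qed.

Lemma ppt_rho_AB d (a b eps : R) : ~~ odd d -> (0 < d)%N ->
  0 <= a -> 0 <= b -> 0 <= eps <= 1 ->
  eps * d%:R <= (1 - eps) * (1 - (1 + d%:R) * a - b) ->
  is_ppt (rho_AB d a b eps).
Proof.
move=> d_even d0 a0 b0 /andP[e0 e1] ec.
have dR0 : 0 <= d%:R :> R := ler0n _ _.
have e1' : 0 <= 1 - eps by lra.
rewrite /is_ppt ptrans_rho_AB_sum //.
apply: psdmxD; [apply: psdmxD; [apply: psdmxD|]|].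
- by apply: psdmxZ (psdmx1 _); rewrite divr_ge0 ?exprn_ge0 // subr_ge0.
- apply: psdmxZ; first by rewrite mulr_ge0 // divr_ge0.
  exact: psdmx_addinvol (flip_adj _) (flip_flip _).
- by apply: psdmxZ (psdmx_ketbra _); exact: mulr_ge0.
- apply: psdmxZ; first exact: divr_ge0.
  exact: psdmx_addinvol (flipO_adj _) (flipO_sqr d_even).
Qed.

(** Supplies the signs of the coefficients of [a] and [b] in both decompositions. *)
Lemma region_gt0 d (a b : R) : (4 <= d)%N -> region R d (a, b) ->
  0 < a /\ 0 < b.
Proof.
move=> d4 [/= h1 h2 h3]; have {}d4 : 4 <= d%:R :> R by rewrite ler_nat.
move: d%:R d4 h1 h2 h3 => D d4 h1 h2 h3.
have h1' : D - 3 < (D + 1) * (a + b * (D - 3)).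
  have -> : (D + 1) * (a + b * (D - 3)) =
      ((D - 3)^-1 * a + b) * ((D + 1) * (D - 3)).
    by field; apply/negP => /eqP; lra.
  rewrite -ltr_pdivrMr; last by apply: mulr_gt0; lra.
  rewrite (_ : _ / _ = (D + 1)^-1) //.
  by field; apply/andP; split; apply/negP => /eqP; lra.
split.
  (* Subtracting this from [h1'] cancels the terms in [b] and leaves [0 < 4 a]. *)
  have : 0 <= (D - 3) * (1 - (a + (1 + D) * b)) by apply: mulr_ge0; lra.
  by lra.
(* Bounding [(1 + D) a] by [1 - b] in [h1'] makes this product exceed [D - 4], which is
   nonnegative. *)
have : 0 < b * ((D + 1) * (D - 3) - 1) by lra.
by rewrite pmulr_lgt0 //; nra.
Qed.

(** Raising [b] by half the radius of a ball inside the region stays in it. The resulting slack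
    leaves room for [eps] in the PPT condition. *)
Lemma interior_region_lt d (a b : R) : interior (region R d) (a, b) ->
  (1 + d%:R) * a + b < 1.
Proof.
move=> /nbhs_ballP[e /= e0 /(_ (a, b + e / 2))].
case=> [|_ _ /=]; last by lra.
split => /=; rewrite -ball_normE /= ?subrr ?normr0 //.
by rewrite opprD addNKr normrN gtr0_norm; lra.
Qed.

End State.

(** * The range of [eps] and the bound on the Schmidt number *)

Theorem corollary4p9 (R : realType) (d : nat) (d_ge4 : (4 <= d)%N)
    (d_even : ~~ odd d) (a b : R) (ab_int : interior (region R d) (a, b)) :
  \forall eps \near 0^'+,
    [/\ quantum_state (rho_AB d a b eps), is_ppt (rho_AB d a b eps) &
        (d./2 <= schmidt_number (rho_AB d a b eps))%N].
Proof.
have ab_in := nbhs_singleton ab_int.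
have [a0 b0] := region_gt0 d_ge4 ab_in.
have [/= h1 h2 _] := ab_in.
have := interior_region_lt ab_int; rewrite -subr_gt0.
set c := (X in 0 < X) => c0.
have d1 : (1 < d)%N by exact: leq_trans d_ge4.
have d0 := ltnW d1.
have dR4 : 4 <= d%:R :> R by rewrite ler_nat.
(* The solution of [eps * d = (1 - eps) * c], where the identity coefficient of the partial
   transpose vanishes. *)
pose e1 := c / (c + d%:R).
have e1_gt0 : 0 < e1 by apply: divr_gt0; lra.
have e1_lt1 : e1 < 1 by rewrite /e1 ltr_pdivrMr; lra.
near=> eps.
have eps0 : 0 < eps by near: eps; exact: nbhs_right_gt.
have eps1 : eps < e1 by near: eps; exact: nbhs_right_lt.
have eps01 : 0 <= eps <= 1 by apply/andP; split; lra.
have tr1 : \tr (rho_AB d a b eps) = 1 by exact: tr_rho_AB.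
split.
- by split=> //; apply: psdmx_rho_AB => //; exact: ltW.
- apply: ppt_rho_AB; rewrite ?ltW //.
  move: eps1; rewrite /e1 ltr_pdivlMr; last by lra.
  by rewrite /c; lra.
have : schmidt_number_le (rho_AB d a b eps) d.
  apply: schmidt_cone_number_le => //.
  by apply: schmidt_cone_rho_AB => //; exact: ltW.
move=> /schmidt_number_attained; set r := schmidt_number _ => rP.
rewrite leqNgt; apply/negP => r_lt.
(* The assumption [r < d./2] makes [d./2] positive, so the predecessor is not truncated and
   [r <= k]. *)
pose k := d./2.-1.
have dE : (2 * k + 2)%N = d.
  rewrite /k -[RHS](even_halfK d_even); case: d./2 r_lt => // n _.
  by rewrite addn2 mul2n.
have rk : (r <= k)%N by rewrite /k -ltnS prednK //; exact: leq_ltn_trans r_lt.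
have rkP : schmidt_number_le (rho_AB d a b eps) k.
  case: rP => [N [p [xi [p0 p1 xn xr rE]]]].
  exists N, p, xi; split => // i; have [q xq qr] := xr i.
  by exists q => //; exact: leq_trans rk.
have := tr_witness_ge0 d_even d0 rkP.
rewrite tr_witness_rho_AB // lecR pmulr_rge0; last by lra.
(* The terms in [a] combine through [(d - 3) / 2 + 2 = (d + 1) / 2]; the last factor is negative by
   the first inequality of [region]. *)
have -> : (d%:R - 3) / 2 * (1 - a - b - b * d%:R) - 2 * a =
  (d%:R - 3) * (d%:R + 1) / 2 * ((d%:R + 1)^-1 - ((d%:R - 3)^-1 * a + b)).
  by field; apply/andP; split; apply/negP => /eqP; lra.
rewrite pmulr_rge0; first by rewrite subr_ge0 leNgt h1.
by apply: divr_gt0 => //; apply: mulr_gt0; lra.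
Unshelve. all: by end_near. Qed.
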